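(* For every $\mathsf{SKS}$ derivation $\Phi$ there exists a super-streamlined $\mathsf{SKS}$ derivation with the same premiss and the same conclusion as $\Phi$.
   Context: Formulae are built from the units $\mathsf f$ (false) and $\mathsf t$ (true), atoms $a,b,\dots$, disjunction $[\alpha\vee\beta]$ and conjunction $(\alpha\wedge\beta)$; on atoms there is an involution $a\mapsto\bar a$ with $\bar a\neq a$ (negation only applies to atoms). A context $\xi\{\ \}$ is a formula with a hole. An inference step of a rule $\alpha/\beta$ (premiss $\alpha$ above, conclusion $\beta$ below) rewrites $\xi\{\alpha\}$ into $\xi\{\beta\}$ for an arbitrary context $\xi$ (deep inference). A derivation from $\alpha$ (premiss) to $\beta$ (conclusion) is a finite chain of inference steps starting at $\alpha$ and ending at $\beta$; a proof is a derivation with premiss $\mathsf t$. System $\mathsf{SKS}$ consists of: interaction $\mathsf{ai}{\downarrow}$: $\mathsf t/[a\vee\bar a]$; weakening $\mathsf{aw}{\downarrow}$: $\mathsf f/a$; contraction $\mathsf{ac}{\downarrow}$: $[a\vee a]/a$; cointeraction or cut $\mathsf{ai}{\uparrow}$: $(a\wedge\bar a)/\mathsf f$; coweakening $\mathsf{aw}{\uparrow}$: $a/\mathsf t$; cocontraction $\mathsf{ac}{\uparrow}$: $a/(a\wedge a)$ (for every atom $a$); switch $(\alpha\wedge[\beta\vee\gamma])/[(\alpha\wedge\beta)\vee\gamma]$; medial $[(\alpha\wedge\beta)\vee(\gamma\wedge\delta)]/([\alpha\vee\gamma]\wedge[\beta\vee\delta])$; and the rule $\gamma/\delta$ whenever $\gamma=\delta$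 is (either direction of) an instance of: commutativity and associativity of $\vee$ and $\wedge$, $[\alpha\vee\mathsf f]=\alpha$, $(\alpha\wedge\mathsf t)=\alpha$, $[\mathsf t\vee\mathsf t]=\mathsf t$, $(\mathsf f\wedge\mathsf f)=\mathsf f$. An atomic flow is a tuple $(V,E,\eta,up,lo)$: finite sets $V$ (vertices) and $E$ (edges), a labelling $\eta$ of vertices by one of interaction ($\mathsf{ai}{\downarrow}$), cut ($\mathsf{ai}{\uparrow}$), weakening ($\mathsf{aw}{\downarrow}$), coweakening ($\mathsf{aw}{\uparrow}$), contraction ($\mathsf{ac}{\downarrow}$), cocontraction ($\mathsf{ac}{\uparrow}$), and maps $up:E\to V\cup\{\top\}$, $lo:E\to V\cup\{\bot\}$ ($\top,\bot\notin V$). The upper edges of a vertex $\nu$ are those $\epsilon$ with $lo(\epsilon)=\nu$, its lower edges those with $up(\epsilon)=\nu$. The (number of upper, number of lower) edges must be $(0,2)$ for interaction, $(2,0)$ for cut, $(0,1)$ for weakening, $(1,0)$ for coweakening, $(2,1)$ for contraction, $(1,2)$ for cocontraction; the directed graph has no directed cycle; and there is a map $\pi:E\to\{+,-\}$ such that all edges of each (co)contraction vertex get the same sign and the two edges of each interaction or cut vertex get different signs. Flows are considered up to isomorphism. The atomic flow associated with an $\mathsf{SKS}$ derivation $\Phi$ is obtained by tracing atom occurrences: each atom occurrence of $\Phi$ is mapped to an edge; in every inference step, occurrences in the context and (for switch, medial and $=$) in the subformulae instantiating $\alpha,\beta,\gamma,\delta$ are mapped to the same edges in the step's premiss and conclusion;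 each step of one of the six atomic (structural) rules gives a vertex labelled by that rule, whose upper edges are the atom occurrences of the redex in the step's premiss and whose lower edges are the atom occurrences of the redex in the step's conclusion; occurrences in the premiss of $\Phi$ are edges with $up=\top$ and those in the conclusion edges with $lo=\bot$. An $\mathsf{SKS}$ derivation is streamlined if in its associated atomic flow there is no directed path (sequence of edges $\epsilon_1,\dots,\epsilon_h$ with $lo(\epsilon_i)=up(\epsilon_{i+1})$) from an interaction or weakening vertex to a cut or coweakening vertex. It is super-streamlined if it is streamlined and its atomic flow is normal (no reduction applies) for the following weakening reductions on flows, each of which replaces a subgraph: (i) a weakening whose lower edge is an upper edge of a contraction: delete both and merge the contraction's other upper edge with its lower edge into one edge; (ii) dually, a coweakening whose upper edge is a lower edge of a cocontraction: delete both and merge the cocontraction's upper edge with its other lower edge; (iii) a weakening whose lower edge is an upper edge of a cut: delete both and make the cut's other upper edge the upper edge of a new coweakening; (iv) dually, an interaction one of whose lower edges is the upper edge of a coweakening: delete both and make the other lower edge the lower edge of a new weakening; (v) an edge from a weakening to a coweakening: delete it and both vertices; (vi) a weakening whose lower edge is the upper edge of a cocontraction: replace by two weakenings whose lower edges are the cocontraction's two lower edges; (vii) dually, a coweakening whose upper edge is the lower edge of a contraction: replace by two coweakenings whose upper edges are the contraction's two upper edges. *)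

(* Defs.v *)
From Stdlib Require Import List Relations.
Import ListNotations.

Set Implicit Arguments.

Section SKS.

Variable A : Type.
Variable bar : A -> A.      (* involution on atoms (hypotheses in the theorem) *)

Inductive formula : Type :=
| Ff : formula
| Tt : formula
| At : A -> formula
| Or : formula -> formula -> formula
| And : formula -> formula -> formula.

Definition pos := list bool.

Fixpoint sub (phi : formula) (p : pos) : option formula :=
  match p with
  | [] => Some phi
  | b :: p' =>
      match phi with
      | Or x y | And x y => sub (if b then y else x) p'
      | _ => None
      end
  end.

Definition atompos (phi : formula) (p : pos) : Prop :=
  exists a, sub phi p = Some (At a).

Inductive ctx : Type :=
| Hole : ctx
| COrL : ctx -> formula -> ctx
| COrR : formula -> ctx -> ctx
| CAndL : ctx -> formula -> ctx
| CAndR : formula -> ctx -> ctx.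

Fixpoint plug (c : ctx) (phi : formula) : formula :=
  match c with
  | Hole => phi
  | COrL c' y => Or (plug c' phi) y
  | COrR x c' => Or x (plug c' phi)
  | CAndL c' y => And (plug c' phi) y
  | CAndR x c' => And x (plug c' phi)
  end.

Fixpoint cpos (c : ctx) : pos :=
  match c with
  | Hole => []
  | COrL c' _ | CAndL c' _ => false :: cpos c'
  | COrR _ c' | CAndR _ c' => true :: cpos c'
  end.

(* instances of the rules of SKS.  For the equations, the boolean [d]
   selects the direction (true: left-to-right as written below). *)
Inductive rinst : Type :=
| RAIdown : A -> rinst
| RAWdown : A -> rinst
| RACdown : A -> rinst
| RAIup : A -> rinst
| RAWup : A -> rinst
| RACup : A -> rinst
| RSwitch : formula -> formula -> formula -> rinst
| RMedial : formula -> formula -> formula -> formula -> rinst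
| RComOr : formula -> formula -> rinst
| RComAnd : formula -> formula -> rinst
| RAssocOr : formula -> formula -> formula -> bool -> rinst
| RAssocAnd : formula -> formula -> formula -> bool -> rinst
| RUnitOr : formula -> bool -> rinst
| RUnitAnd : formula -> bool -> rinst
| RTT : bool -> rinst
| RFF : bool -> rinst.

Definition orient (d : bool) (l r : formula) : formula * formula :=
  if d then (l, r) else (r, l).

Definition rule (r : rinst) : formula * formula :=
  match r with
  | RAIdown a => (Tt, Or (At a) (At (bar a)))
  | RAWdown a => (Ff, At a)
  | RACdown a => (Or (At a) (At a), At a)
  | RAIup a => (And (At a) (At (bar a)), Ff)
  | RAWup a => (At a, Tt)
  | RACup a => (At a, And (At a) (At a))
  | RSwitch x y z => (And x (Or y z), Or (And x y) z)
  | RMedial x y z w => (Or (And x y) (And z w), And (Or x z) (Or y w))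
  | RComOr x y => (Or x y, Or y x)
  | RComAnd x y => (And x y, And y x)
  | RAssocOr x y z d => orient d (Or x (Or y z)) (Or (Or x y) z)
  | RAssocAnd x y z d => orient d (And x (And y z)) (And (And x y) z)
  | RUnitOr x d => orient d (Or x Ff) x
  | RUnitAnd x d => orient d (And x Tt) x
  | RTT d => orient d (Or Tt Tt) Tt
  | RFF d => orient d (And Ff Ff) Ff
  end.

Definition prem (r : rinst) : formula := fst (rule r).
Definition concl (r : rinst) : formula := snd (rule r).

Inductive akind : Type :=
| KAIdown | KAWdown | KACdown | KAIup | KAWup | KACup.

Definition kind (r : rinst) : option akind :=
  match r with
  | RAIdown _ => Some KAIdown
  | RAWdown _ => Some KAWdown
  | RACdown _ => Some KACdown
  | RAIup _ => Some KAIup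
  | RAWup _ => Some KAWup
  | RACup _ => Some KACup
  | _ => None
  end.

(* Tracking of atom occurrences inside the redex of a non-atomic rule:
   position (relative to the redex) in the premiss |-> position in the
   conclusion of the same occurrence (in the subformula instantiating
   alpha, beta, gamma, delta).  Atomic rules track nothing: occurrences of
   their redexes are the upper / lower edges of the corresponding vertex. *)
Definition assoc_fw (p : pos) : option pos :=
  (* [x v [y v z]] -> [[x v y] v z] *)
  match p with
  | false :: q => Some (false :: false :: q)
  | true :: false :: q => Some (false :: true :: q)
  | true :: true :: q => Some (true :: q)
  | _ => None
  end.

Definition assoc_bw (p : pos) : option pos :=
  match p with
  | false :: false :: q => Some (false :: q)
  | false :: true :: q => Some (true :: false :: q)
  | true :: q => Some (true :: true :: q)
  | _ => None
  end.

Definition unit_fw (p : pos) : option pos :=   (* [x v f] -> x *)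
  match p with
  | false :: q => Some q
  | _ => None
  end.

Definition unit_bw (p : pos) : option pos := Some (false :: p).  (* x -> [x v f] *)

Definition trk (r : rinst) (p : pos) : option pos :=
  match r with
  | RSwitch _ _ _ =>
      match p with
      | false :: q => Some (false :: false :: q)
      | true :: false :: q => Some (false :: true :: q)
      | true :: true :: q => Some (true :: q)
      | _ => None
      end
  | RMedial _ _ _ _ =>
      match p with
      | false :: false :: q => Some (false :: false :: q)
      | false :: true :: q => Some (true :: false :: q)
      | true :: false :: q => Some (false :: true :: q)
      | true :: true :: q => Some (true :: true :: q)
      | _ => None
      end
  | RComOr _ _ | RComAnd _ _ =>
      match p with
      | b :: q => Some (negb b :: q)
      | [] => None
      end
  | RAssocOr _ _ _ d | RAssocAnd _ _ _ d => if d then assoc_fw p else assoc_bw p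
  | RUnitOr _ d | RUnitAnd _ d => if d then unit_fw p else unit_bw p
  | _ => None
  end.

Definition step : Type := (ctx * rinst)%type.

Fixpoint derivation (alpha : formula) (ss : list step) (beta : formula) : Prop :=
  match ss with
  | [] => alpha = beta
  | (c, r) :: ss' => alpha = plug c (prem r) /\ derivation (plug c (concl r)) ss' beta
  end.

Definition F (alpha : formula) (ss : list step) (i : nat) : formula :=
  match i with
  | O => alpha
  | S k => match nth_error ss k with
           | Some (c, r) => plug c (concl r)
           | None => alpha
           end
  end.

Definition step_link (s : step) (p q : pos) : Prop :=
  let (c, r) := s in
  (exists p' q', p = cpos c ++ p' /\ trk r p' = Some q' /\ q = cpos c ++ q')
  \/ ((forall p', p <> cpos c ++ p') /\ q = p).

(* atom occurrences of the derivation are pairs (i, p): occurrence at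
   position p of the i-th formula.  Two occurrences are linked if they are
   mapped to the same edge by one step. *)
Definition link (alpha : formula) (ss : list step) (x y : nat * pos) : Prop :=
  let (i, p) := x in let (j, q) := y in
  j = S i /\
  exists s, nth_error ss i = Some s /\
    atompos (F alpha ss i) p /\ atompos (F alpha ss j) q /\ step_link s p q.

Definition reach (alpha : formula) (ss : list step) : relation (nat * pos) :=
  clos_refl_trans (nat * pos) (link alpha ss).

(* vertices of the atomic flow: the steps (indices) of atomic rules *)
Definition vertex_kind (ss : list step) (i : nat) (k : akind) : Prop :=
  exists c r, nth_error ss i = Some (c, r) /\ kind r = Some k.

(* there is an edge of the atomic flow with up = vertex i and lo = vertex j:
   a lower edge of vertex i (an atom occurrence of the redex in the
   conclusion of step i) is the same edge as an upper edge of vertex j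
   (an atom occurrence of the redex in the premiss of step j) *)
Definition flow_edge (alpha : formula) (ss : list step) (i j : nat) : Prop :=
  exists ci ri cj rj p' q',
    nth_error ss i = Some (ci, ri) /\ nth_error ss j = Some (cj, rj) /\
    kind ri <> None /\ kind rj <> None /\
    atompos (concl ri) p' /\ atompos (prem rj) q' /\
    reach alpha ss (S i, cpos ci ++ p') (j, cpos cj ++ q').

Definition flow_path (alpha : formula) (ss : list step) : relation nat :=
  clos_trans nat (flow_edge alpha ss).

Definition streamlined (alpha : formula) (ss : list step) : Prop :=
  forall i j ki kj,
    vertex_kind ss i ki -> vertex_kind ss j kj ->
    (ki = KAIdown \/ ki = KAWdown) -> (kj = KAIup \/ kj = KAWup) ->
    ~ flow_path alpha ss i j.

Definition edge_kinds (alpha : formula) (ss : list step) (k1 k2 : akind) : Prop :=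
  exists i j, vertex_kind ss i k1 /\ vertex_kind ss j k2 /\ flow_edge alpha ss i j.

Definition weak_redex (alpha : formula) (ss : list step) : Prop :=
     edge_kinds alpha ss KAWdown KACdown
  \/ edge_kinds alpha ss KACup KAWup
  \/ edge_kinds alpha ss KAWdown KAIup
  \/ edge_kinds alpha ss KAIdown KAWup
  \/ edge_kinds alpha ss KAWdown KAWup
  \/ edge_kinds alpha ss KAWdown KACup
  \/ edge_kinds alpha ss KACdown KAWup.

Definition flow_normal (alpha : formula) (ss : list step) : Prop :=
  ~ weak_redex alpha ss.

Definition super_streamlined (alpha : formula) (ss : list step) : Prop :=
  streamlined alpha ss /\ flow_normal alpha ss.

End SKS.

Arguments Ff {A}.
Arguments Tt {A}.
Arguments Hole {A}.

(* Main.v *)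
(** Streamlining only constrains the order of the atomic rules: if, along the
    derivation, all coweakenings precede all cuts and cocontractions, which
    precede all interactions and contractions, which precede all weakenings,
    then no forbidden path or redex can exist, since flow edges go downwards.

    Such a derivation is found semantically. By soundness the premiss
    [alpha] and the negation of the conclusion [beta] have no common model, and
    a tableau for the pair yields, as in Maehara's interpolation method, a
    formula [gamma] such that [alpha] derives [gamma] and [neg beta] derives
    [neg gamma] by cuts, coweakenings and cocontractions only. Coweakenings
    permute to the top of both derivations, and negating the second one turns
    it upside down into a derivation from [gamma] to [beta]. *)

Require Import Defs.
From Stdlib Require Import List Relations Classical Lia.
Import ListNotations.

Set Implicit Arguments.

(** * Derivations using only prescribed atomic rules *)

Section Derivability.

Variable A : Type.
Variable bar : A -> A.

Notation fm := (formula A).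

(** Switch, medial and the equations have [kind] equal to [None], so they are allowed for every [P];
    only the atomic rules are restricted. *)
Definition uses (P : akind -> Prop) (s : step A) : Prop :=
  forall k, kind (snd s) = Some k -> P k.

Definition derives (P : akind -> Prop) (x y : fm) : Prop :=
  exists ss, derivation bar x ss y /\ Forall (uses P) ss.

Lemma uses_weaken (P Q : akind -> Prop) ss :
  (forall k, P k -> Q k) -> Forall (uses P) ss -> Forall (uses Q) ss.
Proof. intros HPQ; apply Forall_impl; unfold uses; auto. Qed.

Lemma derivation_app x ss y tt z :
  derivation bar x ss y -> derivation bar y tt z ->
  derivation bar x (ss ++ tt) z.
Proof.
  revert x; induction ss as [|[c r] ss IH]; simpl; intros x H1 H2.
  - now subst.
  - destruct H1; split; auto.
Qed.

Lemma derives_refl P x : derives P x x.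
Proof. exists []; split; simpl; auto. Qed.

Lemma derives_trans P y x z : derives P x y -> derives P y z -> derives P x z.
Proof.
  intros [s [H1 H2]] [t [H3 H4]]; exists (s ++ t); split.
  - eapply derivation_app; eauto.
  - now apply Forall_app.
Qed.

Lemma derives_mono (P Q : akind -> Prop) x y :
  (forall k, P k -> Q k) -> derives P x y -> derives Q x y.
Proof.
  intros HPQ [s [H1 H2]]; exists s; split; [|eapply uses_weaken]; eauto.
Qed.

Lemma derives_rule (P : akind -> Prop) r :
  (forall k, kind r = Some k -> P k) -> derives P (prem bar r) (concl bar r).
Proof.
  intros H; exists [(Hole, r)]; split; simpl; auto.
Qed.

Lemma derives_map (P : akind -> Prop) (K : ctx A -> ctx A) (k : fm -> fm) :
  (forall c x, plug (K c) x = k (plug c x)) ->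
  forall x y, derives P x y -> derives P (k x) (k y).
Proof.
  intros HK x y [s [H1 H2]].
  exists (map (fun t => (K (fst t), snd t)) s); split.
  - clear H2; revert x H1; induction s as [|[c r] s IH]; simpl; intros x H1.
    + now subst.
    + destruct H1 as [-> H1]; rewrite !HK; auto.
  - apply Forall_map; exact H2.
Qed.

Lemma derives_plug P c x y : derives P x y -> derives P (plug c x) (plug c y).
Proof.
  intros H; induction c as [|c IH z|z c IH|c IH z|z c IH]; simpl; auto.
  - apply (derives_map (fun c => COrL c z) (fun x => Or x z)); auto.
  - apply (derives_map (COrR z) (Or z)); auto.
  - apply (derives_map (fun c => CAndL c z) (fun x => And x z)); auto.
  - apply (derives_map (CAndR z) (And z)); auto.
Qed.

Lemma derives_or P x x' y y' :
  derives P x x' -> derives P y y' -> derives P (Or x y) (Or x' y').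
Proof.
  intros H1 H2; apply derives_trans with (Or x' y).
  - apply (@derives_plug P (COrL Hole y) _ _ H1).
  - apply (@derives_plug P (COrR x' Hole) _ _ H2).
Qed.

Lemma derives_and P x x' y y' :
  derives P x x' -> derives P y y' -> derives P (And x y) (And x' y').
Proof.
  intros H1 H2; apply derives_trans with (And x' y).
  - apply (@derives_plug P (CAndL Hole y) _ _ H1).
  - apply (@derives_plug P (CAndR x' Hole) _ _ H2).
Qed.

Lemma derives_lin P r : kind r = None -> derives P (prem bar r) (concl bar r).
Proof. intros H; apply derives_rule; intros k; rewrite H; discriminate. Qed.

Lemma comm_or P x y : derives P (Or x y) (Or y x).
Proof. now apply (derives_lin P (RComOr x y)). Qed.
Lemma comm_and P x y : derives P (And x y) (And y x).
Proof. now apply (derives_lin P (RComAnd x y)). Qed.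
Lemma assoc_or_l P x y z : derives P (Or x (Or y z)) (Or (Or x y) z).
Proof. now apply (derives_lin P (RAssocOr x y z true)). Qed.
Lemma assoc_or_r P x y z : derives P (Or (Or x y) z) (Or x (Or y z)).
Proof. now apply (derives_lin P (RAssocOr x y z false)). Qed.
Lemma assoc_and_l P x y z : derives P (And x (And y z)) (And (And x y) z).
Proof. now apply (derives_lin P (RAssocAnd x y z true)). Qed.
Lemma assoc_and_r P x y z : derives P (And (And x y) z) (And x (And y z)).
Proof. now apply (derives_lin P (RAssocAnd x y z false)). Qed.
Lemma or_unit_elim P x : derives P (Or x Ff) x.
Proof. now apply (derives_lin P (RUnitOr x true)). Qed.
Lemma or_unit_intro P x : derives P x (Or x Ff).
Proof. now apply (derives_lin P (RUnitOr x false)). Qed.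
Lemma and_unit_elim P x : derives P (And x Tt) x.
Proof. now apply (derives_lin P (RUnitAnd x true)). Qed.
Lemma and_unit_intro P x : derives P x (And x Tt).
Proof. now apply (derives_lin P (RUnitAnd x false)). Qed.
Lemma true_or_true_elim P : derives P (Or Tt Tt) Tt.
Proof. now apply (derives_lin P (RTT A true)). Qed.
Lemma true_or_true_intro P : derives P Tt (Or Tt Tt).
Proof. now apply (derives_lin P (RTT A false)). Qed.
Lemma false_and_false_elim P : derives P (And Ff Ff) Ff.
Proof. now apply (derives_lin P (RFF A true)). Qed.
Lemma false_and_false_intro P : derives P Ff (And Ff Ff).
Proof. now apply (derives_lin P (RFF A false)). Qed.
Lemma switch P x y z : derives P (And x (Or y z)) (Or (And x y) z).
Proof. now apply (derives_lin P (RSwitch x y z)). Qed.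
Lemma medial P x y z w :
  derives P (Or (And x y) (And z w)) (And (Or x z) (Or y w)).
Proof. now apply (derives_lin P (RMedial x y z w)). Qed.

(** Obtained without any atomic rule: [Tt] is split into [Or Tt Tt] next to [Ff], and switch frees
    one copy from the conjunction. *)
Lemma false_true P : derives P Ff Tt.
Proof.
  apply derives_trans with (And Ff Tt); [apply and_unit_intro|].
  apply derives_trans with (And Ff (Or Tt Tt)).
  { apply derives_and; [apply derives_refl|apply true_or_true_intro]. }
  apply derives_trans with (Or (And Ff Tt) Tt); [apply switch|].
  apply derives_trans with (Or Ff Tt).
  { apply derives_or; [apply and_unit_elim|apply derives_refl]. }
  apply derives_trans with (Or Tt Ff); [apply comm_or|apply or_unit_elim].
Qed.

(** * Non-atomic inferences derivable with the up-rules *)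

Definition up (k : akind) : Prop := k = KAIup \/ k = KAWup \/ k = KACup.

Lemma up_true x : derives up x Tt.
Proof.
  induction x as [| |a|x IHx y IHy|x IHx y IHy].
  - apply false_true.
  - apply derives_refl.
  - apply (derives_rule up (RAWup a)); unfold up; simpl; intuition congruence.
  - apply derives_trans with (Or Tt Tt);
      [now apply derives_or|apply true_or_true_elim].
  - apply derives_trans with (And Tt Tt);
      [now apply derives_and|apply and_unit_elim].
Qed.

(** Cocontraction reduces to atoms: medial recombines the copies of a disjunction, rearranging
    conjuncts those of a conjunction. *)
Lemma up_dup x : derives up x (And x x).
Proof.
  induction x as [| |a|x IHx y IHy|x IHx y IHy].
  - apply false_and_false_intro.
  - apply and_unit_intro.
  - apply (derives_rule up (RACup a)); unfold up; simpl; intuition congruence.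
  - apply derives_trans with (Or (And x x) (And y y));
      [now apply derives_or|apply medial].
  - apply derives_trans with (And (And x x) (And y y)); [now apply derives_and|].
    apply derives_trans with (And x (And x (And y y))); [apply assoc_and_r|].
    apply derives_trans with (And x (And y (And x y))); [|apply assoc_and_l].
    apply derives_and; [apply derives_refl|].
    apply derives_trans with (And (And x y) y); [apply assoc_and_l|apply comm_and].
Qed.

Lemma up_and_l x y : derives up (And x y) x.
Proof.
  apply derives_trans with (And x Tt); [|apply and_unit_elim].
  apply derives_and; [apply derives_refl|apply up_true].
Qed.

Lemma up_and_r x y : derives up (And x y) y.
Proof. eapply derives_trans; [apply comm_and|apply up_and_l]. Qed.

Lemma up_pair x y z :
  derives up x y -> derives up x z -> derives up x (And y z).
Proof.
  intros; apply derives_trans with (And x x);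
    [apply up_dup|now apply derives_and].
Qed.

Lemma up_cut a : derives up (And (At a) (At (bar a))) Ff.
Proof.
  apply (derives_rule up (RAIup a)); unfold up; simpl; intuition congruence.
Qed.

(** After [z] is duplicated, one switch carries each copy to one of the two disjuncts. *)
Lemma up_distr x y z :
  derives up (And (Or x y) z) (Or (And x z) (And y z)).
Proof.
  apply derives_trans with (And (And z (Or x y)) z).
  { apply derives_trans with (And (Or x y) (And z z)).
    { apply derives_and; [apply derives_refl|apply up_dup]. }
    apply derives_trans with (And (And (Or x y) z) z); [apply assoc_and_l|].
    apply derives_and; [apply comm_and|apply derives_refl]. }
  apply derives_trans with (And z (Or y (And x z))).
  { eapply derives_trans; [apply comm_and|].
    apply derives_and; [apply derives_refl|].
    eapply derives_trans; [apply switch|].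
    eapply derives_trans; [apply comm_or|].
    apply derives_or; [apply derives_refl|apply comm_and]. }
  eapply derives_trans; [apply switch|].
  eapply derives_trans; [apply comm_or|].
  apply derives_or; [apply derives_refl|apply comm_and].
Qed.

Definition conj (G : list fm) : fm := fold_right (@And A) Tt G.

Lemma up_conj_in G x : In x G -> derives up (conj G) x.
Proof.
  induction G as [|y G IH]; simpl; [tauto|intros [->|H]].
  - apply up_and_l.
  - eapply derives_trans; [apply up_and_r|auto].
Qed.

Lemma up_conj_intro z G :
  (forall x, In x G -> derives up z x) -> derives up z (conj G).
Proof.
  induction G as [|y G IH]; simpl; intros H.
  - apply up_true.
  - apply up_pair; auto.
Qed.

(** * Coweakenings permute upwards *)

(** The effect of coweakening any set of atom occurrences in parallel. *)
Inductive thins : fm -> fm -> Prop :=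
| thins_refl x : thins x x
| thins_atom a : thins (At a) Tt
| thins_or x x' y y' : thins x x' -> thins y y' -> thins (Or x y) (Or x' y')
| thins_and x x' y y' : thins x x' -> thins y y' -> thins (And x y) (And x' y').

Lemma thins_derives x y : thins x y -> derives (eq KAWup) x y.
Proof.
  induction 1.
  - apply derives_refl.
  - apply (derives_rule (eq KAWup) (RAWup a)); simpl; congruence.
  - now apply derives_or.
  - now apply derives_and.
Qed.

Lemma thins_or_inv x y z : thins (Or x y) z ->
  exists x' y', z = Or x' y' /\ thins x x' /\ thins y y'.
Proof. inversion 1; subst; eauto 6 using thins_refl. Qed.

Lemma thins_and_inv x y z : thins (And x y) z ->
  exists x' y', z = And x' y' /\ thins x x' /\ thins y y'.
Proof. inversion 1; subst; eauto 6 using thins_refl. Qed.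

Lemma thins_true_inv z : thins Tt z -> z = Tt.
Proof. now inversion 1. Qed.

Lemma thins_false_inv z : thins Ff z -> z = Ff.
Proof. now inversion 1. Qed.

Lemma thins_atom_inv a z : thins (At a) z -> z = At a \/ z = Tt.
Proof. inversion 1; auto. Qed.

Definition cutcoc (k : akind) : Prop := k = KAIup \/ k = KACup.

Ltac thins_inv :=
  repeat match goal with
  | H : thins (Or _ _) _ |- _ =>
      apply thins_or_inv in H; destruct H as (?x & ?y & -> & ? & ?)
  | H : thins (And _ _) _ |- _ =>
      apply thins_and_inv in H; destruct H as (?x & ?y & -> & ? & ?)
  | H : thins Tt _ |- _ => apply thins_true_inv in H; subst
  | H : thins Ff _ |- _ => apply thins_false_inv in H; subst
  | H : thins (At _) _ |- _ => apply thins_atom_inv in H; destruct H as [->| ->]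
  end.

(** Pulls a thinning from below a rule to above it. A linear rule only moves subformulae, so their
    thinnings move along; a coweakening is absorbed into the thinning above. *)
Lemma thins_rule r z :
  uses up (Hole, r) -> thins (concl bar r) z ->
  exists x, thins (prem bar r) x /\ derives cutcoc x z.
Proof.
  intros Hr H; unfold concl in H; destruct r; simpl in H;
    try (exfalso; specialize (Hr _ eq_refl); unfold up in Hr;
         intuition congruence);
    try match goal with d : bool |- _ => destruct d; simpl in H end;
    thins_inv; unfold prem; simpl.
  - exists (And (At a) (At (bar a))); split; [apply thins_refl|].
    apply (derives_rule cutcoc (RAIup a)); unfold cutcoc; simpl;
      intuition congruence.
  - exists Tt; split; [apply thins_atom|apply derives_refl].
  - exists (At a); split; [apply thins_refl|].
    apply (derives_rule cutcoc (RACup a)); unfold cutcoc; simpl;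
      intuition congruence.
  (* If one copy of a cocontracted atom is thinned, a unit equation replaces the cocontraction; if
     both are, the atom itself is thinned. *)
  - exists (At a); split; [apply thins_refl|].
    eapply derives_trans; [apply and_unit_intro|apply comm_and].
  - exists (At a); split; [apply thins_refl|apply and_unit_intro].
  - exists Tt; split; [apply thins_atom|apply and_unit_intro].
  - eexists; split; [|apply switch]; auto using thins.
  - eexists; split; [|apply medial]; auto using thins.
  - eexists; split; [|apply comm_or]; auto using thins.
  - eexists; split; [|apply comm_and]; auto using thins.
  - eexists; split; [|apply assoc_or_l]; auto using thins.
  - eexists; split; [|apply assoc_or_r]; auto using thins.
  - eexists; split; [|apply assoc_and_l]; auto using thins.
  - eexists; split; [|apply assoc_and_r]; auto using thins.
  - eexists; split; [|apply or_unit_elim]; auto using thins.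
  - eexists; split; [|apply or_unit_intro]; auto.
  - eexists; split; [|apply and_unit_elim]; auto using thins.
  - eexists; split; [|apply and_unit_intro]; auto.
  - eexists; split; [|apply true_or_true_elim]; auto using thins.
  - eexists; split; [|apply true_or_true_intro]; auto using thins.
  - eexists; split; [|apply false_and_false_elim]; auto using thins.
  - eexists; split; [|apply false_and_false_intro]; auto using thins.
Qed.

Lemma thins_step c r z :
  uses up (c, r) -> thins (plug c (concl bar r)) z ->
  exists x, thins (plug c (prem bar r)) x /\ derives cutcoc x z.
Proof.
  intros Hr; revert z; induction c as [|c IH y|y c IH|c IH y|y c IH];
    simpl; intros z H.
  - now apply thins_rule.
  - apply thins_or_inv in H as (u & v & -> & H1 & H2).
    destruct (IH Hr _ H1) as (x & Hx & Hd); exists (Or x v); split.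
    + now apply thins_or.
    + apply derives_or; [assumption|apply derives_refl].
  - apply thins_or_inv in H as (u & v & -> & H1 & H2).
    destruct (IH Hr _ H2) as (x & Hx & Hd); exists (Or u x); split.
    + now apply thins_or.
    + apply derives_or; [apply derives_refl|assumption].
  - apply thins_and_inv in H as (u & v & -> & H1 & H2).
    destruct (IH Hr _ H1) as (x & Hx & Hd); exists (And x v); split.
    + now apply thins_and.
    + apply derives_and; [assumption|apply derives_refl].
  - apply thins_and_inv in H as (u & v & -> & H1 & H2).
    destruct (IH Hr _ H2) as (x & Hx & Hd); exists (And u x); split.
    + now apply thins_and.
    + apply derives_and; [apply derives_refl|assumption].
Qed.

(** The thinning starts as the identity at the conclusion and climbs step by step, collecting the
    coweakenings it meets; the steps left below use only cuts and cocontractions. *)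
Lemma up_thins_first x y : derives up x y ->
  exists z, derives (eq KAWup) x z /\ derives cutcoc z y.
Proof.
  intros [ss [H1 H2]].
  cut (exists z, thins x z /\ derives cutcoc z y).
  { intros (z & Hz & Hd); exists z; auto using thins_derives. }
  revert x H1; induction H2 as [|[c r] ss Hr H2 IH]; simpl; intros x H1.
  - subst; exists y; split; [apply thins_refl|apply derives_refl].
  - destruct H1 as [-> H1]; destruct (IH _ H1) as (z & Hz & Hd).
    destruct (thins_step Hr Hz) as (u & Hu & Hd').
    exists u; split; [|eapply derives_trans]; eauto.
Qed.

(** * Negation turns derivations upside down *)

Fixpoint neg (x : fm) : fm :=
  match x with
  | Ff => Tt
  | Tt => Ff
  | At a => At (bar a)
  | Or x y => And (neg x) (neg y)
  | And x y => Or (neg x) (neg y)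
  end.

Definition flip (k : akind) : akind :=
  match k with
  | KAIdown => KAIup | KAWdown => KAWup | KACdown => KACup
  | KAIup => KAIdown | KAWup => KAWdown | KACup => KACdown
  end.

Fixpoint neg_ctx (c : ctx A) : ctx A :=
  match c with
  | Hole => Hole
  | COrL c y => CAndL (neg_ctx c) (neg y)
  | COrR x c => CAndR (neg x) (neg_ctx c)
  | CAndL c y => COrL (neg_ctx c) (neg y)
  | CAndR x c => COrR (neg x) (neg_ctx c)
  end.

Lemma neg_plug c x : neg (plug c x) = plug (neg_ctx c) (neg x).
Proof. induction c; simpl; congruence. Qed.

(** The rules of the system are closed under De Morgan duality: an atomic rule on [a] becomes its
    flipped rule on [bar a], medial is self-dual, and the equations for the two connectives are
    exchanged. *)
Lemma neg_rule (P : akind -> Prop) r : uses P (Hole, r) ->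
  derives (fun k => P (flip k)) (neg (concl bar r)) (neg (prem bar r)).
Proof.
  intros Hr; set (Q := fun k => P (flip k)).
  assert (HQ : forall s, option_map flip (kind s) = kind r ->
                 derives Q (prem bar s) (concl bar s)).
  { intros s E; apply derives_rule; intros k Hk; rewrite Hk in E.
    now apply Hr. }
  destruct r as [a|a|a|a|a|a|x y z|x y z w|x y|x y|x y z []|x y z []
                |x []|x []|[]|[]]; unfold prem, concl; simpl.
  - now apply (HQ (RAIup (bar a))).
  - now apply (HQ (RAWup (bar a))).
  - now apply (HQ (RACup (bar a))).
  - now apply (HQ (RAIdown (bar a))).
  - now apply (HQ (RAWdown (bar a))).
  - now apply (HQ (RACdown (bar a))).
  (* Switch is self-dual up to commutativity: its dual absorbs the conjunct on the other side. *)
  - eapply derives_trans; [apply comm_and|].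
    eapply derives_trans; [|apply comm_or].
    eapply derives_trans; [|apply derives_or; [apply comm_and|apply derives_refl]].
    eapply derives_trans;
      [apply derives_and; [apply derives_refl|apply comm_or]|apply switch].
  - apply medial.
  - apply comm_and.
  - apply comm_or.
  - apply assoc_and_r.
  - apply assoc_and_l.
  - apply assoc_or_r.
  - apply assoc_or_l.
  - apply and_unit_intro.
  - apply and_unit_elim.
  - apply or_unit_intro.
  - apply or_unit_elim.
  - apply false_and_false_intro.
  - apply false_and_false_elim.
  - apply true_or_true_intro.
  - apply true_or_true_elim.
Qed.

Lemma derives_neg (P : akind -> Prop) x y : derives P x y ->
  derives (fun k => P (flip k)) (neg y) (neg x).
Proof.
  intros [ss [H1 H2]]; revert x H1.
  induction H2 as [|[c r] ss Hr H2 IH]; simpl; intros x H1.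
  - subst; apply derives_refl.
  - destruct H1 as [-> H1]; eapply derives_trans; [exact (IH _ H1)|].
    rewrite !neg_plug; apply derives_plug; now apply neg_rule.
Qed.

(** * Interpolation *)

(** A model is a set of true atoms in which [a] and [bar a] are independent. Consistency and
    completeness link them, the latter only on a finite list, so that models can be built atom by
    atom. *)
Fixpoint eval (S : A -> Prop) (x : fm) : Prop :=
  match x with
  | Ff => False
  | Tt => True
  | At a => S a
  | Or x y => eval S x \/ eval S y
  | And x y => eval S x /\ eval S y
  end.

Definition consistent (S : A -> Prop) : Prop := forall a, S a -> S (bar a) -> False.
Definition complete (L : list A) (S : A -> Prop) : Prop :=
  forall a, In a L -> S a \/ S (bar a).

Definition unsat (L : list A) (G : list fm) : Prop :=
  forall S, consistent S -> complete L S -> ~ (forall x, In x G -> eval S x).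

Lemma eval_plug S c x y :
  (eval S x -> eval S y) -> eval S (plug c x) -> eval S (plug c y).
Proof. induction c; simpl; tauto. Qed.

(* The atoms on which excluded middle is needed for soundness. *)
Definition interaction_atom (s : step A) : list A :=
  match snd s with RAIdown a => [a] | _ => [] end.

Lemma derivation_sound x ss y S :
  consistent S -> complete (flat_map interaction_atom ss) S ->
  derivation bar x ss y -> eval S x -> eval S y.
Proof.
  intros HS; revert x; induction ss as [|[c r] ss IH]; simpl; intros x HL H Hx.
  - now subst.
  - destruct H as [-> H]; apply IH with (plug c (concl bar r)); auto.
    { intros a Ha; apply HL, in_or_app; auto. }
    revert Hx; apply eval_plug.
    destruct r as [a|a|a|a|a|a|?|?|?|?|? ? ? []|? ? ? []|? []|? []|[]|[]];
      unfold prem, concl; simpl; try tauto.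
    (* Interaction is the only rule that calls on completeness, cut the only one that calls on
       consistency. *)
    + intros _; apply HL; simpl; auto.
    + intros [H1 H2]; exact (HS a H1 H2).
Qed.

Lemma eval_neg S x : consistent S -> eval S x -> eval S (neg x) -> False.
Proof. intros HS; induction x; simpl; try tauto; apply HS. Qed.

Hypothesis bar_inv : forall a, bar (bar a) = a.

Lemma neg_neg x : neg (neg x) = x.
Proof. induction x; simpl; congruence. Qed.

Hypothesis bar_neq : forall a, bar a <> a.

Lemma consistent_completion L S : consistent S ->
  exists S', consistent S' /\ complete L S' /\ forall a, S a -> S' a.
Proof.
  revert S; induction L as [|a L IH]; intros S HS.
  - exists S; repeat split; auto; intros a [].
  - assert (HT : exists T, consistent T /\ (T a \/ T (bar a)) /\
                   forall b, S b -> T b).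
    { destruct (classic (S a \/ S (bar a))) as [H|H]; [now exists S|].
      (* Neither [a] nor [bar a] is in [S], so adding [a] can clash only with itself, which
         [bar_neq] excludes. *)
      exists (fun b => S b \/ b = a); repeat split; auto.
      intros b [H1| ->] [H2|H2].
      - exact (HS b H1 H2).
      - apply H; right; now rewrite <- H2, bar_inv.
      - apply H; now right.
      - exact (bar_neq H2). }
    destruct HT as (T & HT1 & HT2 & HT3).
    destruct (IH T HT1) as (S' & H1 & H2 & H3).
    exists S'; repeat split; auto.
    intros b [<-|Hb]; [destruct HT2; auto|auto].
Qed.

(** The two lists are the two sides of a split tableau branch, and [g] is the Maehara interpolant
    separating them. *)
Definition interpolable (G H : list fm) : Prop :=
  exists g, derives up (conj G) g /\ derives up (conj H) (neg g).

Lemma interpolable_sym G H : interpolable G H -> interpolable H G.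
Proof. intros (g & H1 & H2); exists (neg g); rewrite neg_neg; auto. Qed.

Lemma interpolable_up G G' H :
  derives up (conj G) (conj G') -> interpolable G' H -> interpolable G H.
Proof.
  intros HG (g & H1 & H2); exists g; split; auto.
  eapply derives_trans; eauto.
Qed.

Lemma interpolable_false G H : derives up (conj G) Ff -> interpolable G H.
Proof. intros HG; exists Ff; split; [assumption|apply up_true]. Qed.

(** The interpolants of the two branches are joined by a disjunction: the left side distributes over
    the branches, and on the right the negated interpolant is a conjunction. *)
Lemma interpolable_or x y G H :
  interpolable (x :: G) H -> interpolable (y :: G) H ->
  interpolable (Or x y :: G) H.
Proof.
  intros (g & H1 & H2) (g' & H3 & H4); exists (Or g g'); split.
  - eapply derives_trans; [apply up_distr|now apply derives_or].
  - now apply up_pair.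
Qed.

(** The leaves of the tableau. A clash within [As] gives the interpolant [Ff], within [Bs] it gives
    [Tt], and across the two sides it gives the clashing atom of [As]. Without a clash the atoms
    extend to a model, against unsatisfiability. *)
Lemma interpolable_atoms L As Bs :
  unsat L (map (@At A) As ++ map (@At A) Bs) ->
  interpolable (map (@At A) As) (map (@At A) Bs).
Proof.
  intros HU.
  assert (Hclash : forall Cs a, In a Cs -> In (bar a) Cs ->
            derives up (conj (map (@At A) Cs)) Ff).
  { intros Cs a H1 H2; eapply derives_trans; [|apply (up_cut a)].
    apply up_pair; apply up_conj_in, in_map; assumption. }
  assert (Hcross : forall a, In a As -> In (bar a) Bs ->
            interpolable (map (@At A) As) (map (@At A) Bs)).
  { intros a H1 H2; exists (At a); split;
      [|change (neg (At a)) with (At (bar a))];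
      apply up_conj_in, in_map; assumption. }
  destruct (classic (interpolable (map (@At A) As) (map (@At A) Bs)))
    as [|Hno]; [assumption|exfalso].
  destruct (@consistent_completion L (fun a => In a (As ++ Bs)))
    as (S & HS & HL & HAB).
  { intros a H1 H2; apply Hno.
    apply in_app_or in H1; apply in_app_or in H2.
    destruct H1 as [H1|H1], H2 as [H2|H2].
    - now apply interpolable_false, (Hclash As a).
    - now apply (Hcross a).
    - apply (Hcross (bar a)); [|rewrite bar_inv]; assumption.
    - now apply interpolable_sym, interpolable_false, (Hclash Bs a). }
  apply (HU S HS HL); intros x Hx; rewrite <- map_app in Hx.
  apply in_map_iff in Hx as (a & <- & Ha); now apply HAB.
Qed.

Fixpoint size (x : fm) : nat :=
  match x with
  | Or x y | And x y => S (size x + size y)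
  | _ => 1
  end.

(** Tableau decomposition of the left side with the right side fixed, leaving leaves that have only
    atoms on the left. *)
Lemma interpolable_left L H :
  (forall As, unsat L (map (@At A) As ++ H) ->
              interpolable (map (@At A) As) H) ->
  forall G, unsat L (G ++ H) -> interpolable G H.
Proof.
  intros Hbase.
  (* [As] stores the atoms already met. Only [G] is measured, so moving an atom into [As] counts as
     progress. *)
  assert (Hmain : forall n G As, list_sum (map size G) < n ->
            unsat L (G ++ map (@At A) As ++ H) ->
            interpolable (G ++ map (@At A) As) H).
  { induction n as [|n IH]; [lia|]; intros [|x G] As Hn HU; [now apply Hbase|].
    simpl in Hn, HU; destruct x as [| |a|x y|x y]; simpl in Hn.
    - apply interpolable_false, up_and_l.
    - apply interpolable_up with (G ++ map (@At A) As); [apply up_and_r|].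
      apply IH; [lia|]; intros S HS HL HG; apply (HU S HS HL).
      intros z [<-|Hz]; simpl; auto.
    - apply interpolable_up with (G ++ map (@At A) (a :: As)).
      { apply up_conj_intro; intros z Hz; apply up_conj_in; simpl in *.
        rewrite in_app_iff in *; simpl in Hz; tauto. }
      apply IH; [lia|]; intros S HS HL HG; apply (HU S HS HL).
      intros z Hz; apply HG; simpl in *.
      rewrite !in_app_iff in *; simpl; rewrite in_app_iff; tauto.
    - apply interpolable_or; [apply (IH (x :: G))|apply (IH (y :: G))];
        try (simpl; lia);
        intros S HS HL HG; apply (HU S HS HL);
        intros z [<-|Hz]; try (apply HG; now right);
        [left|right]; apply HG; now left.
    - apply interpolable_up with (x :: y :: G ++ map (@At A) As);
        [apply assoc_and_r|].
      apply (IH (x :: y :: G)); [simpl; lia|].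
      intros S HS HL HG; apply (HU S HS HL).
      intros z [<-|Hz]; [split; apply HG; simpl; auto|apply HG; now do 2 right]. }
  intros G HU; specialize (Hmain _ G [] (le_n _)).
  rewrite app_nil_r in Hmain; auto.
Qed.

Lemma unsat_swap L G H : unsat L (G ++ H) -> unsat L (H ++ G).
Proof.
  intros HU S HS HL HG; apply (HU S HS HL); intros x Hx; apply HG.
  rewrite in_app_iff in *; tauto.
Qed.

(** The left side is decomposed first; symmetry of interpolants then lets the same lemma decompose
    the right side, down to pairs of lists of atoms. *)
Lemma interpolation L G H : unsat L (G ++ H) -> interpolable G H.
Proof.
  apply interpolable_left; intros As HU.
  apply interpolable_sym, (@interpolable_left L); [|now apply unsat_swap].
  intros Bs HU'; apply interpolable_sym, (@interpolable_atoms L).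
  now apply unsat_swap.
Qed.

(** * Ordering the atomic rules *)

(** Chosen so that each weakening redex and each path forbidden by streamlining would lead from a
    vertex to one of strictly smaller rank. *)
Definition rank (k : akind) : nat :=
  match k with
  | KAWup => 0
  | KAIup | KACup => 1
  | KAIdown | KACdown => 2
  | KAWdown => 3
  end.

Definition ordered (ss : list (step A)) : Prop :=
  forall i j k l, vertex_kind ss i k -> vertex_kind ss j l -> i < j ->
    rank k <= rank l.

Lemma vertex_kind_uses P ss i k :
  Forall (uses P) ss -> vertex_kind ss i k -> P k.
Proof.
  rewrite Forall_forall; intros H (c & r & Hi & Hk).
  exact (H _ (nth_error_In _ _ Hi) k Hk).
Qed.

Lemma vertex_kind_app (s t : list (step A)) i k : vertex_kind (s ++ t) i k ->
  (i < length s /\ vertex_kind s i k) \/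
  (length s <= i /\ vertex_kind t (i - length s) k).
Proof.
  intros (c & r & Hi & Hk); destruct (Compare_dec.lt_dec i (length s)).
  - rewrite nth_error_app1 in Hi by assumption; left; split; auto.
    now exists c, r.
  - rewrite nth_error_app2 in Hi by lia; right; split; [lia|].
    now exists c, r.
Qed.

Lemma ordered_same_rank n ss : Forall (uses (fun k => rank k = n)) ss -> ordered ss.
Proof.
  intros H i j k l Hi Hj _.
  apply (vertex_kind_uses H) in Hi, Hj; lia.
Qed.

Lemma ordered_app n s t :
  Forall (uses (fun k => rank k <= n)) s -> ordered s ->
  Forall (uses (fun k => n <= rank k)) t -> ordered t -> ordered (s ++ t).
Proof.
  intros Hs Os Ht Ot i j k l Hi Hj Hij.
  apply vertex_kind_app in Hi as [[Hi Ki]|[Hi Ki]];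
    apply vertex_kind_app in Hj as [[Hj Kj]|[Hj Kj]]; try lia.
  - eapply Os; eauto.
  - pose proof (vertex_kind_uses Hs Ki).
    pose proof (vertex_kind_uses Ht Kj); simpl in *; lia.
  - apply (Ot _ _ _ _ Ki Kj); lia.
Qed.

Lemma reach_le x ss p q : reach bar x ss p q -> fst p <= fst q.
Proof.
  induction 1 as [[i p] [j q] [-> _]| |]; simpl in *; lia.
Qed.

Lemma flow_edge_lt x ss i j : flow_edge bar x ss i j -> i < j.
Proof.
  intros (? & ? & ? & ? & ? & ? & _ & _ & _ & _ & _ & _ & H).
  (* The lower edges of vertex [i] start in formula [S i], so reaching formula [j] gives [S i <= j],
     which is [i < j]. *)
  apply reach_le in H; exact H.
Qed.

Lemma ordered_super_streamlined x ss :
  ordered ss -> super_streamlined bar x ss.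
Proof.
  intros Hss.
  assert (Hedge : forall k l, rank l < rank k -> ~ edge_kinds bar x ss k l).
  { intros k l Hkl (i & j & Hi & Hj & He); apply flow_edge_lt in He.
    specialize (Hss _ _ _ _ Hi Hj He); lia. }
  split.
  - intros i j k l Hi Hj Hk Hl Hp.
    assert (Hij : i < j).
    { clear - Hp; induction Hp as [i j H|]; [exact (flow_edge_lt H)|lia]. }
    specialize (Hss _ _ _ _ Hi Hj Hij).
    destruct Hk as [-> | ->], Hl as [-> | ->]; simpl in Hss; lia.
  - unfold flow_normal, weak_redex.
    intros H; repeat destruct H as [H|H]; revert H; apply Hedge; simpl; lia.
Qed.

End Derivability.

(** * Assembling the four phases *)

Theorem theorem5p25 (A : Type) (bar : A -> A)
  (bar_inv : forall a, bar (bar a) = a) (bar_neq : forall a, bar a <> a)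
  (alpha beta : formula A) (Phi : list (step A)) :
  derivation bar alpha Phi beta ->
  exists Psi : list (step A),
    derivation bar alpha Psi beta /\ super_streamlined bar alpha Psi.
Proof.
  intros HPhi.
  (* Completeness is asked exactly on the interaction atoms of [Phi], which is what its soundness
     requires; a model of both formulae would then satisfy [beta] and its negation. *)
  destruct (@interpolation A bar bar_inv bar_neq
              (flat_map (@interaction_atom A) Phi) [alpha] [neg bar beta])
    as (gamma & Hl & Hr).
  { intros S HS HL H.
    apply (eval_neg beta HS); [|apply H; simpl; auto].
    apply (derivation_sound alpha Phi beta HS HL HPhi), H; simpl; auto. }
  simpl in Hl, Hr.
  (* The conjunction of a singleton list carries a trailing [Tt], introduced by the unit
     equation. *)
  assert (Hl' : derives bar up alpha gamma)
    by (eapply derives_trans; [apply and_unit_intro|exact Hl]).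
  assert (Hr' : derives bar up (neg bar beta) (neg bar gamma))
    by (eapply derives_trans; [apply and_unit_intro|exact Hr]).
  apply up_thins_first in Hl' as (alpha' & D1 & D2).
  apply up_thins_first in Hr' as (beta' & D4 & D3).
  (* After negation, [D3] leads from [gamma] to the negation of [beta'] by interactions and
     contractions, and [D4] from there to [beta] by weakenings. *)
  apply derives_neg in D3, D4; rewrite !neg_neg in * by assumption.
  assert (Hrank : forall n (P : akind -> Prop) x y,
            (forall k, P k -> rank k = n) -> derives bar P x y ->
            exists ss, derivation bar x ss y /\
                       Forall (uses (fun k => rank k = n)) ss).
  { intros n P x y HP H; exact (derives_mono (fun k => rank k = n) HP H). }
  apply (Hrank 0) in D1 as (s1 & D1 & U1); [|intros k <-; reflexivity].
  apply (Hrank 1) in D2 as (s2 & D2 & U2);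
    [|intros k [-> | ->]; reflexivity].
  apply (Hrank 2) in D3 as (s3 & D3 & U3);
    [|intros [] [H|H]; try discriminate H; reflexivity].
  apply (Hrank 3) in D4 as (s4 & D4 & U4);
    [|intros [] H; try discriminate H; reflexivity].
  exists (s1 ++ s2 ++ s3 ++ s4); split.
  - repeat (eapply derivation_app; [eassumption|]); assumption.
  - assert (Hle : forall m n (s : list (step A)), m <= n ->
              Forall (uses (fun k => rank k = n)) s ->
              Forall (uses (fun k => m <= rank k)) s)
      by (intros m n s Hmn; apply uses_weaken; lia).
    assert (Hge : forall n (s : list (step A)),
              Forall (uses (fun k => rank k = n)) s ->
              Forall (uses (fun k => rank k <= n)) s)
      by (intros n s; apply uses_weaken; lia).
    apply ordered_super_streamlined.
    apply (ordered_app (n := 0)); [auto|eapply ordered_same_rank; eauto| |].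
    { repeat (apply Forall_app; split); eapply Hle; [|eassumption| |eassumption| |eassumption]; lia. }
    apply (ordered_app (n := 1)); [auto|eapply ordered_same_rank; eauto| |].
    { apply Forall_app; split; eapply Hle; try eassumption; lia. }
    apply (ordered_app (n := 2)); eauto using ordered_same_rank.
Qed.
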